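(* Let $r\ge1$ and let $D=\{-r,\dots,r\}^2\subseteq\mathbb{Z}^2$ be the relative $r$-neighborhood of the king grid. Let $a,b$ be non-negative integers with $a\neq b$. Then every $(D,b,a)$-covering is two-periodic.
   Context: A $(D,b,a)$-covering is a configuration $c\in\{0,1\}^{\mathbb{Z}^2}$ such that for every $\vec u\in\mathbb{Z}^2$, the number of $\vec v\in\vec u+D$ with $c_{\vec v}=1$ equals $a$ if $c_{\vec u}=0$ and equals $b$ if $c_{\vec u}=1$. (The king grid has vertex set $\mathbb{Z}^2$, with $\vec u,\vec v$ adjacent iff $\vec u-\vec v\in\{(\pm1,0),(0,\pm1),(\pm1,\pm1)\}$.) A configuration $c$ is $\vec t$-periodic if $c_{\vec u+\vec t}=c_{\vec u}$ for all $\vec u$. It is two-periodic if it is $\vec t_1$- and $\vec t_2$-periodic for two linearly independent $\vec t_1,\vec t_2\in\mathbb{Z}^2$. *)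

(* Defs.v *)
From HB Require Import structures.
From mathcomp Require Import all_boot all_order all_algebra.
From mathcomp Require Import finmap.

Set Implicit Arguments.
Unset Strict Implicit.
Unset Printing Implicit Defensive.

Import Order.TTheory GRing.Theory Num.Theory.
Local Open Scope fset_scope.
Local Open Scope ring_scope.

(* Z^2, with its componentwise additive group structure. *)
Notation Z2 := (int * int)%type.

(* A configuration in {0,1}^(Z^2); [true] stands for 1. *)
Definition configuration : Type := Z2 -> bool.

Definition translate (u : Z2) (D : {fset Z2}) : {fset Z2} :=
  [fset u + d | d in D].

(* As in the notation "(D, b, a)-covering", [b] is the count around a cell
   containing 1 and [a] the count around a cell containing 0. *)
Definition covering (D : {fset Z2}) (b a : nat) (c : configuration) : Prop :=
  forall u : Z2,
    #|` [fset v in translate u D | c v]| = if c u then b else a.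

Definition sym_interval (r : nat) : {fset int} :=
  [fset k%:Z - r%:Z | k in iota 0 (2 * r + 1)].

Definition king_nbhd (r : nat) : {fset Z2} :=
  (sym_interval r `*` sym_interval r)%fset.

Lemma in_sym_interval (r : nat) (x : int) :
  (x \in sym_interval r) = (- r%:Z <= x <= r%:Z).
Proof.
apply/imfsetP/andP => /= [[k] | [h1 h2]].
  rewrite mem_iota add0n => /andP[_ hk] ->; split.
    by rewrite lerBrDr addNr.
  by move: hk; rewrite addn1 ltnS lerBlDr -PoszD lez_nat addnn -mul2n.
have h : 0 <= x + r%:Z by rewrite -lerBlDr sub0r.
exists (absz (x + r%:Z)); last by rewrite gez0_abs // addrK.
rewrite mem_iota /= add0n addn1 ltnS -lez_nat gez0_abs //.
by rewrite mul2n -addnn PoszD lerD2r.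
Qed.

Lemma in_king_nbhd (r : nat) (z : Z2) :
  (z \in king_nbhd r) =
  (- r%:Z <= z.1 <= r%:Z) && (- r%:Z <= z.2 <= r%:Z).
Proof. by rewrite in_fsetM !in_sym_interval. Qed.

Definition periodic (t : Z2) (c : configuration) : Prop :=
  forall u : Z2, c (u + t) = c u.

(* Linear independence over Z, which for vectors of Z^2 is the same as over Q
   or R. *)
Definition lin_indep (t1 t2 : Z2) : Prop :=
  forall m n : int, t1 *~ m + t2 *~ n = 0 -> m = 0 /\ n = 0.

Definition two_periodic (c : configuration) : Prop :=
  exists t1 t2 : Z2, [/\ lin_indep t1 t2, periodic t1 c & periodic t2 c].

(* Main.v *)
(** Let [d] be the difference of two translates of a covering. With
    [n = 2r+1], its sum over every [n * n] square is [m = b - a <> 0] times its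
    central value. Suppose that [d] vanishes on [2r] consecutive rows over a
    long enough interval. On that interval the next row [e] has zero sums over
    [n] consecutive cells, so it is [n]-periodic, and the row [h] lying [r]
    rows further satisfies [h(x+n) - h(x) = m (e(x+r+1) - e(x+r))]. Hence [h]
    drifts linearly along steps of [n] unless [e] is constant; as [|h| <= 1],
    [e] is constant, and then zero. Thus zeros spread from a box to a vertical
    strip and, exchanging coordinates, to the whole plane: a covering is
    determined by its restriction to a fixed box, and the pigeonhole principle
    gives a period in every direction. *)
Require Import Defs.
From mathcomp Require Import all_boot all_order all_algebra.
From mathcomp Require Import finmap.
From mathcomp Require Import zify.

Set Implicit Arguments.
Unset Strict Implicit.
Unset Printing Implicit Defensive.

Import Order.TTheory GRing.Theory Num.Theory.
Local Open Scope fset_scope.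
Local Open Scope ring_scope.

Lemma sum_shift1 (n : nat) (f : nat -> int) (x : nat) :
  \sum_(i < n) f (x.+1 + i)%N - \sum_(i < n) f (x + i)%N = f (x + n)%N - f x.
Proof.
elim: n => [|n IH]; first by rewrite !big_ord0 addn0 !subrr.
by rewrite !big_ord_recr /= opprD addrACA IH addSnnS addrC addrA subrK.
Qed.

Lemma drift_eq0 (r : nat) (m : int) (e h : nat -> int) (n := (2 * r).+1)
    (L := (4 * n)%N) :
  m != 0 -> (forall x, `|h x| <= 1) ->
  (forall x, (x + n <= L)%N -> e (x + n)%N = e x) ->
  (forall x, (x + n <= L)%N ->
     h (x + n)%N - h x = m * (e (x + r).+1 - e (x + r)%N)) ->
  \sum_(i < n) e (r + i)%N = 0 ->
  forall x, (x <= L)%N -> e x = 0.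
Proof.
move=> m0 hb per drift sum0.
(* Since [e] is [n]-periodic, three successive drifts add up to
   [3 * m * (e (x + r).+1 - e (x + r))]. This is a difference of two values of [h], so at most 2 in
   absolute value, and the integer bracket is 0. *)
have step x : (x + 3 * n <= L)%N -> e (x + r).+1 = e (x + r)%N.
  move=> hx.
  have := drift x ltac:(lia); have := drift (x + n)%N ltac:(lia).
  have := drift (x + n + n)%N ltac:(lia).
  rewrite (_ : x + n + n + r = x + r + n + n)%N; last lia.
  rewrite (_ : x + n + r = x + r + n)%N; last lia.
  rewrite -!addSn !per; try lia.
  have := hb x; have := hb (x + n + n + n)%N; nia.
have const i : (i < n)%N -> e (r + i)%N = e r.
  elim: i => [|i IH] hi; first by rewrite addn0.
  by rewrite addnS addnC step ?[(i + r)%N]addnC ?IH //; lia.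
have er : e r = 0.
  move: sum0; under eq_bigr => i _ do rewrite const //.
  by rewrite sumr_const card_ord => /eqP; rewrite mulrn_eq0 => /eqP.
have right x : (r <= x <= L)%N -> e x = 0.
  elim/ltn_ind: x => x IH hx; case: (ltnP x (r + n)%N) => hxn.
    by rewrite -(subnKC (_ : r <= x)%N) ?const ?er //; lia.
  by rewrite -(subnK (_ : n <= x)%N) ?per ?IH //; lia.
move=> x hx; case: (leqP r x) => hr; first by apply: right; lia.
by rewrite -per ?right //; lia.
Qed.

Lemma next_row_eq0 (r : nat) (m : int) (d : nat -> nat -> int)
    (n := (2 * r).+1) (L := (4 * n)%N) :
  (0 < r)%N -> m != 0 -> (forall x y, `|d x y| <= 1) ->
  (forall x y, \sum_(j < n) \sum_(i < n) d (x + i)%N (y + j)%N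
               = m * d (x + r)%N (y + r)%N) ->
  (forall x y, (x <= L)%N -> (y < 2 * r)%N -> d x y = 0) ->
  forall x, (x <= L)%N -> d x (2 * r)%N = 0.
Proof.
move=> r0 m0 db eqd d0.
pose g y x := \sum_(i < n) d (x + i)%N y.
have g0 x y : (x + 2 * r <= L)%N -> (y < 2 * r)%N -> g y x = 0.
  by move=> hx hy; apply: big1 => i _; apply: d0 => //; have := ltn_ord i; lia.
(* The square on rows [0] to [2 * r] has its centre on row [r], a zero row as [0 < r], and only its
   last row can contribute. *)
have ge x : (x + 2 * r <= L)%N -> g (2 * r)%N x = 0.
  move=> hx; have := eqd x 0%N.
  rewrite d0; [|lia|lia]; rewrite mulr0 big_ord_recr big1 /= ?add0r //.
  by move=> j _; apply: g0 => //; have := ltn_ord j; lia.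
(* Sliding the square from first row [r - 1] to first row [r] trades the zero row [r - 1] for row
   [3 * r] and moves the centre from the zero row [2 * r - 1] to row [2 * r]. *)
have gh x : (x + 2 * r <= L)%N -> g (3 * r)%N x = m * d (x + r)%N (2 * r)%N.
  move=> hx; have := sum_shift1 n (g^~ x) r.-1.
  rewrite prednK // !eqd (g0 x r.-1) //; last lia.
  rewrite (d0 _ (r.-1 + r)%N); [|lia|lia].
  rewrite (_ : r.-1 + n = 3 * r)%N; last lia.
  by rewrite mulr0 !subr0 (_ : r + r = 2 * r)%N //; lia.
apply: (drift_eq0 (m := m) (h := d^~ (3 * r)%N)) => //; rewrite -/n.
- move=> x hx; apply/eqP; rewrite -subr_eq0 -(sum_shift1 n (d^~ (2 * r)%N)).
  by have := ge x ltac:(lia); have := ge x.+1 ltac:(lia); rewrite /g => -> ->.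
- move=> x hx; rewrite -(sum_shift1 n (d^~ (3 * r)%N)).
  have := gh x ltac:(lia); have := gh x.+1 ltac:(lia).
  by rewrite /g => -> ->; rewrite addSn mulrBr.
- by apply: ge; lia.
Qed.

(** Eigenfunctions of summation over the king neighbourhood; squares are anchored at a corner so
    that offsets are natural numbers. *)
Definition square_eigen (r : nat) (m : int) (d : int -> int -> int) : Prop :=
  forall x y : int,
    \sum_(j < (2 * r).+1) \sum_(i < (2 * r).+1) d (x + i%:Z) (y + j%:Z)
    = m * d (x + r%:Z) (y + r%:Z).

Lemma square_eigen_transpose (r : nat) (m : int) (d : int -> int -> int) :
  square_eigen r m d -> square_eigen r m (fun x y => d y x).
Proof. by move=> eqd x y; rewrite exchange_big; apply: eqd. Qed.

Lemma square_eigen_reflect (r : nat) (m : int) (d : int -> int -> int) :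
  square_eigen r m d -> square_eigen r m (fun x y => d x (- y)).
Proof.
move=> eqd x y; rewrite (reindex_inj rev_ord_inj) /=.
have -> : - (y + r%:Z) = - y - (2 * r)%:Z + r%:Z by lia.
rewrite -eqd; apply: eq_bigr => j _; apply: eq_bigr => i _; congr d.
by have := ltn_ord j; lia.
Qed.

(** [next_row_eq0] loses no width, so the induction on rows can go on forever. *)
Lemma zero_upward (r : nat) (m : int) (d : int -> int -> int) (A B : int)
    (L := (4 * (2 * r).+1)%N) :
  (0 < r)%N -> m != 0 ->
  square_eigen r m d -> (forall x y, `|d x y| <= 1) ->
  (forall i j, (i <= L)%N -> (j <= L)%N -> d (A + i%:Z) (B + j%:Z) = 0) ->
  forall i j, (i <= L)%N -> d (A + i%:Z) (B + j%:Z) = 0.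
Proof.
move=> r0 m0 eqd db d0 i j; elim/ltn_ind: j i => j IH i hi.
case: (leqP j L) => hj; first exact: d0.
have -> : B + j%:Z = B + (j - 2 * r)%:Z + (2 * r)%:Z by lia.
apply: (next_row_eq0 (m := m)
  (d := fun i k => d (A + i%:Z) (B + (j - 2 * r)%:Z + k%:Z))) => // x y.
- have := eqd (A + x%:Z) (B + (j - 2 * r)%:Z + y%:Z).
  rewrite !PoszD !addrA => <-.
  by apply: eq_bigr => k _; apply: eq_bigr => l _; rewrite !PoszD !addrA.
- by move=> hx hy; rewrite -addrA -PoszD; apply: IH => //; lia.
Qed.

Lemma zero_strip (r : nat) (m : int) (d : int -> int -> int) (A B : int)
    (L := (4 * (2 * r).+1)%N) :
  (0 < r)%N -> m != 0 ->
  square_eigen r m d -> (forall x y, `|d x y| <= 1) ->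
  (forall i j, (i <= L)%N -> (j <= L)%N -> d (A + i%:Z) (B + j%:Z) = 0) ->
  forall i y, (i <= L)%N -> d (A + i%:Z) y = 0.
Proof.
move=> r0 m0 eqd db d0 i y hi; case: (lerP B y) => hy.
  have -> : y = B + (absz (y - B)%R)%:Z by lia.
  exact: (zero_upward r0 m0 eqd).
(* Reflection turns the top row [B + L] of the box into the bottom row of a box, and downward into
   upward. *)
have -> : y = - (- (B + L%:Z) + (absz (B + L%:Z - y)%R)%:Z) by lia.
apply: (zero_upward r0 m0 (square_eigen_reflect eqd)) => // k j hk hj.
have -> : - (- (B + L%:Z) + j%:Z) = B + (L - j)%:Z by lia.
by apply: d0 => //; lia.
Qed.

Lemma zero_plane (r : nat) (m : int) (d : int -> int -> int)
    (L := (4 * (2 * r).+1)%N) :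
  (0 < r)%N -> m != 0 ->
  square_eigen r m d -> (forall x y, `|d x y| <= 1) ->
  (forall i j, (i <= L)%N -> (j <= L)%N -> d i%:Z j%:Z = 0) ->
  forall x y, d x y = 0.
Proof.
move=> r0 m0 eqd db d0 x y; rewrite -[y]addr0.
(* The vertical strip contains a box starting at height [y]; transposed, this box spreads along the
   whole row [y]. *)
apply: (zero_strip r0 m0 (A := y) (B := 0) (square_eigen_transpose eqd)) => //.
by move=> i j _ hj; apply: (zero_strip r0 m0 (A := 0) (B := 0) eqd).
Qed.

Lemma card_translate_king (r : nat) (c : configuration) (x y : int) :
  #|` [fset v in translate (x + r%:Z, y + r%:Z) (king_nbhd r) | c v]|
  = (\sum_(j < (2 * r).+1) \sum_(i < (2 * r).+1) c (x + i%:Z, y + j%:Z)%R)%N.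
Proof.
have [n nE] : exists n, n = (2 * r).+1 by exists (2 * r).+1.
rewrite -nE.
pose s := [seq (x + i%:Z, y + j%:Z) | j <- iota 0 n,
                                       i <- iota 0 n].
have us : uniq s.
  apply: allpairs_uniq; rewrite ?iota_uniq //.
  by move=> [j i] [j' i'] _ _ /= [] h1 h2; congr pair; lia.
have /perm_size -> : perm_eq
    (enum_fset [fset v in translate (x + r%:Z, y + r%:Z) (king_nbhd r) | c v])
    (filter c s).
  apply: uniq_perm; rewrite ?fset_uniq ?filter_uniq // => v.
  rewrite mem_filter !inE andbC; congr andb.
  apply/imfsetP/allpairsP => /= [[[k l]]|[[j i] /= [hj hi ->]]].
    rewrite in_king_nbhd /= => hkl ->.
    exists (absz (l + r%:Z), absz (k + r%:Z)); rewrite /= !mem_iota.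
    by split; [lia|lia|congr pair => /=; lia].
  rewrite !mem_iota in hj hi.
  exists (i%:Z - r%:Z, j%:Z - r%:Z); first by rewrite in_king_nbhd /=; lia.
  by congr pair => /=; lia.
rewrite size_filter -sum1_count big_mkcond big_allpairs_dep /=.
have iotaE (F : nat -> nat) : (\sum_(i <- iota 0 n) F i = \sum_(i < n) F i)%N.
  by rewrite -(big_mkord xpredT) /index_iota subn0.
rewrite iotaE; apply: eq_bigr => j _; rewrite iotaE.
by apply: eq_bigr => i _; case: (c _).
Qed.

(** With both cases written as one affine function of the central value, [a] cancels between two
    translates and the eigenvalue [b - a] remains. *)
Lemma covering_square_sum (r a b : nat) (c : configuration) (u : Z2) :
  covering (king_nbhd r) b a c ->
  \sum_(j < (2 * r).+1) \sum_(i < (2 * r).+1) (c (u + (i%:Z, j%:Z)))%:Z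
  = a%:Z + (b%:Z - a%:Z) * (c (u + (r%:Z, r%:Z)))%:Z.
Proof.
case: u => x y cov.
have := congr1 Posz (cov (x + r%:Z, y + r%:Z)); rewrite card_translate_king.
rewrite (big_morph Posz PoszD (erefl _)).
under eq_bigr => j _ do rewrite (big_morph Posz PoszD (erefl _)).
by move=> /= ->; case: ifP; lia.
Qed.

Lemma covering_period (r a b : nat) (c : configuration) (t : Z2) :
  (0 < r)%N -> a <> b -> covering (king_nbhd r) b a c ->
  exists2 p : nat, (0 < p)%N & periodic (t *+ p) c.
Proof.
move=> r0 ab cov.
pose L := (4 * (2 * r).+1)%N.
pose T := {ffun 'I_L.+1 * 'I_L.+1 -> bool}.
pose pat (k : nat) : T :=
  [ffun ij : 'I_L.+1 * 'I_L.+1 => c ((ij.1%:Z, ij.2%:Z) + t *+ k)].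
(* Pigeonhole: [#|T|.+1] translates along [t] show at most [#|T|] patterns on the box. *)
have /injectivePn [k1 [k2 ne eqp]] :
    ~~ injectiveb (fun k : 'I_#|T|.+1 => pat k).
  by apply/injectiveP => /leq_card; rewrite card_ord ltnn.
wlog lt12 : k1 k2 ne eqp / (k1 < k2)%N.
  move=> wl; case: (ltngtP k1 k2) => [|h|/val_inj e]; first exact: wl.
    by apply: (wl k2 k1); rewrite // eq_sym.
  by rewrite e eqxx in ne.
exists (k2 - k1)%N; first by rewrite subn_gt0.
move=> u; pose d x y : int :=
  (c ((x, y) + t *+ k1))%:Z - (c ((x, y) + t *+ k2))%:Z.
have eqd : square_eigen r (b%:Z - a%:Z) d.
  have eqk k x y : \sum_(j < (2 * r).+1) \sum_(i < (2 * r).+1)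
        (c ((x + i%:Z, y + j%:Z) + t *+ k))%:Z
      = a%:Z + (b%:Z - a%:Z) * (c ((x + r%:Z, y + r%:Z) + t *+ k))%:Z.
    have E i j : (x + i, y + j) + t *+ k = (x, y) + t *+ k + (i, j).
      exact: (addrAC (x, y) (i, j)).
    rewrite E -covering_square_sum //.
    by apply: eq_bigr => j _; apply: eq_bigr => i _; rewrite E.
  move=> x y; rewrite /d.
  under eq_bigr => j _ do rewrite sumrB.
  by rewrite sumrB !eqk mulrBr opprD addrACA subrr add0r.
have db x y : `|d x y| <= 1 by rewrite /d; do 2!case: (c _).
have d0 i j : (i <= L)%N -> (j <= L)%N -> d i%:Z j%:Z = 0.
  move=> hi hj; have := congr1 (fun f : T => f (inord i, inord j)) eqp.
  by rewrite !ffunE /= !inordK // /d => ->; rewrite subrr.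
have m0 : b%:Z - a%:Z != 0 by lia.
(* At [u - t *+ k1] the vanishing difference compares [c u] with [c (u + t *+ (k2 - k1))]. *)
case E : (u - t *+ k1) => [x y].
have := zero_plane r0 m0 eqd db d0 x y.
rewrite /d -E subrK -addrA [- _ + _]addrC -mulrnBr 1?ltnW //.
by do 2!case: (c _).
Qed.

Theorem theorem12 (r a b : nat) (c : configuration) :
  (1 <= r)%N -> a <> b -> covering (king_nbhd r) b a c -> two_periodic c.
Proof.
move=> r0 ab cov.
have [p p0 perp] := covering_period (1, 0) r0 ab cov.
have [q q0 perq] := covering_period (0, 1) r0 ab cov.
exists ((1, 0) *+ p), ((0, 1) *+ q); split=> // m n h.
have := congr1 fst h; have := congr1 snd h.
rewrite !raddfD !raddfMz !raddfMn /= !mul0rn !mul0rz add0r addr0.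
move=> /eqP + /eqP; rewrite !mulrz_eq0 !mulrn_eq0 !oner_eq0 !orbF.
by rewrite !gtn_eqF // !orbF => /eqP -> /eqP ->.
Qed.
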